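(* Let $u(x,t)$ be a sufficiently smooth real-valued solution of the generalized sine-Gordon equation $u_{tx}=(1-\partial_x^2)\sin(u)$, $x\in\mathbb{R}$, $t>0$, such that $\cos(u(x,t))-1$ has sufficient decay as $x\to\pm\infty$ for each $t$, and set $m=1+u_x^2$. Then the following conservation laws hold: $$\left(\cos u+(\cos u)_x-\sqrt m\right)_t=\left(-\frac12\left(\partial_x^{-1}\left(\sin u+(\sin u)_x\right)\right)^2-\left(\cos u+(\cos u)_x-\sqrt m\right)\cos u\right)_x,$$ $$\left(\frac{(mu_x+u_{xx})^2}{2m^{5/2}}\right)_t=\left(\frac{\left(-m\left(m^2+m+m_x\right)-u_{xx}^2\right)\cos u+2m^2u_x\sin u}{2m^{5/2}}\right)_x.$$ Moreover, the following quantities are conserved (independent of $t$): $$H_2=\int_{\mathbb{R}}\frac{1}{8m^{3/2}}\left[\left(\frac{u_{xx}}{m}+u_x\right)^4-\frac{\left(3m_xu_{xx}-2m(u_{xx}+u_{xxx})\right)^2}{m^4}\right]dx,$$ $$H_3=\int_{\mathbb{R}}\frac{1}{16m^{5/2}}\Biggl[-\frac{5(mu_x+u_{xx})^2\left(3m_xu_{xx}-2m(u_{xx}+u_{xxx})\right)^2}{m^6}+\left(\frac{u_{xx}}{m}+u_x\right)^6$$ $$\qquad+\frac{8\left(m^2(u_{xxx}+u_{xxxx})+m\left(-2m_xu_{xx}-5m_xu_{xxx}+15u_{xx}^3\right)-18u_{xx}^3\right)^2}{m^6}\Biggr]dx.$$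
   Context: Subscripts denote partial derivatives, and $\partial_x^{-1}f(x)=\int_{-\infty}^xf(x')\,dx'$. ''Sufficient smoothness and decay'' means that $u$ is regular enough for all derivatives appearing to exist and be continuous, that $u(x,t)$ tends to (time-independent) integer multiples of $2\pi$ and the $x$-derivatives of $u$ tend to $0$ as $x\to\pm\infty$, fast enough that all integrals converge and differentiation in $t$ under the integral sign is permitted. *)

(* Defs.v *)
From Stdlib Require Import Reals.
From Coquelicot Require Import Coquelicot.
Open Scope R_scope.

(* Functions of (x, t) are curried with x first; only their values for t > 0
   matter. *)

Definition pdx (n : nat) (f : R -> R -> R) (x t : R) : R :=
  Derive_n (fun y => f y t) n x.

Definition pdt (f : R -> R -> R) (x t : R) : R := Derive (fun s => f x s) t.

Definition continuous_xt (f : R -> R -> R) : Prop :=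
  forall x t, 0 < t -> continuity_2d_pt f x t.

(* Integrals over unbounded intervals are improper Riemann integrals; the
   functions integrated below are continuous. *)

Definition converges_R (f : R -> R) : Prop :=
  ex_RInt_gen f (Rbar_locally m_infty) (Rbar_locally p_infty).

Definition int_R (f : R -> R) : R :=
  RInt_gen f (Rbar_locally m_infty) (Rbar_locally p_infty).

Definition converges_to (x : R) (f : R -> R) : Prop :=
  ex_RInt_gen f (Rbar_locally m_infty) (at_point x).

Definition int_to (x : R) (f : R -> R) : R :=
  RInt_gen f (Rbar_locally m_infty) (at_point x).

Definition pdx_inv (f : R -> R -> R) (x t : R) : R :=
  int_to x (fun y => f y t).

Definition cosu (u : R -> R -> R) (x t : R) : R := cos (u x t).
Definition sinu (u : R -> R -> R) (x t : R) : R := sin (u x t).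
Definition m_of (u : R -> R -> R) (x t : R) : R := 1 + (pdx 1 u x t) ^ 2.

Definition generalized_sine_Gordon (u : R -> R -> R) : Prop :=
  forall x t, 0 < t ->
    pdx 1 (pdt u) x t = sinu u x t - pdx 2 (sinu u) x t.

Definition H2_density (u : R -> R -> R) (x t : R) : R :=
  let m := m_of u x t in
  let m_x := pdx 1 (m_of u) x t in
  let u_x := pdx 1 u x t in
  let u_xx := pdx 2 u x t in
  let u_xxx := pdx 3 u x t in
  1 / (8 * Rpower m (3 / 2)) *
  ((u_xx / m + u_x) ^ 4
   - (3 * m_x * u_xx - 2 * m * (u_xx + u_xxx)) ^ 2 / m ^ 4).

Definition H3_density (u : R -> R -> R) (x t : R) : R :=
  let m := m_of u x t in
  let m_x := pdx 1 (m_of u) x t in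
  let u_x := pdx 1 u x t in
  let u_xx := pdx 2 u x t in
  let u_xxx := pdx 3 u x t in
  let u_xxxx := pdx 4 u x t in
  1 / (16 * Rpower m (5 / 2)) *
  (- (5 * (m * u_x + u_xx) ^ 2
        * (3 * m_x * u_xx - 2 * m * (u_xx + u_xxx)) ^ 2 / m ^ 6)
   + (u_xx / m + u_x) ^ 6
   + 8 * (m ^ 2 * (u_xxx + u_xxxx)
          + m * (- 2 * m_x * u_xx - 5 * m_x * u_xxx + 15 * u_xx ^ 3)
          - 18 * u_xx ^ 3) ^ 2 / m ^ 6).

Definition H2 (u : R -> R -> R) (t : R) : R :=
  int_R (fun x => H2_density u x t).

Definition H3 (u : R -> R -> R) (t : R) : R :=
  int_R (fun x => H3_density u x t).

(* The H3 density contains u_xxxx, so its t-derivative contains u_xxxxt, which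
   the equation expresses through x-derivatives of u up to order five. *)
Definition sufficiently_smooth (u : R -> R -> R) : Prop :=
  (forall n, (n <= 5)%nat ->
     (forall x t, 0 < t -> ex_derive_n (fun y => u y t) n x)
     /\ continuous_xt (pdx n u))
  /\ (forall n, (n <= 4)%nat ->
        (forall x t, 0 < t -> ex_derive (fun s => pdx n u x s) t)
        /\ continuous_xt (pdt (pdx n u)))
  /\ (forall x t, 0 < t -> ex_derive (fun y => pdt u y t) x)
  /\ continuous_xt (pdx 1 (pdt u)).

(* d/dt of the integral of f exists and is the (convergent) integral of f_t. *)

Definition diff_under_int_R (f : R -> R -> R) : Prop :=
  forall t, 0 < t ->
    converges_R (fun x => pdt f x t)
    /\ is_derive (fun s => int_R (fun x => f x s)) t
                 (int_R (fun x => pdt f x t)).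

Definition diff_under_pdx_inv (f : R -> R -> R) : Prop :=
  forall x t, 0 < t ->
    converges_to x (fun y => pdt f y t)
    /\ is_derive (fun s => pdx_inv f x s) t (pdx_inv (pdt f) x t).

Definition sufficient_decay (u : R -> R -> R) : Prop :=
  (exists k_minus k_plus : Z, forall t, 0 < t ->
     is_lim (fun x => u x t) m_infty (2 * PI * IZR k_minus)
     /\ is_lim (fun x => u x t) p_infty (2 * PI * IZR k_plus))
  /\ (forall n t, (1 <= n <= 4)%nat -> 0 < t ->
        is_lim (fun x => pdx n u x t) m_infty 0
        /\ is_lim (fun x => pdx n u x t) p_infty 0)
  /\ (forall t, 0 < t ->
        converges_R (fun x => cosu u x t - 1)
        /\ (forall x, converges_to x (fun y => sinu u y t + pdx 1 (sinu u) y t))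
        /\ converges_R (fun x => H2_density u x t)
        /\ converges_R (fun x => H3_density u x t))
  /\ diff_under_pdx_inv (fun x t => sinu u x t + pdx 1 (sinu u) x t)
  /\ diff_under_int_R (H2_density u)
  /\ diff_under_int_R (H3_density u).

(* [Derive] is total, so existence of both derivatives is part of the claim. *)
Definition conservation_law (T X : R -> R -> R) : Prop :=
  forall x t, 0 < t ->
    ex_derive (fun s => T x s) t
    /\ ex_derive (fun y => X y t) x
    /\ pdt T x t = pdx 1 X x t.

Definition conserved (H : R -> R) : Prop :=
  forall t1 t2, 0 < t1 -> 0 < t2 -> H t1 = H t2.

(* Main.v *)
Require Import Defs.
From Stdlib Require Import Reals Lra Lia.
From Coquelicot Require Import Coquelicot.
Open Scope R_scope.

(** The equation is a reciprocal transformation of sine-Gordon: sqrt m is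
    conserved with flux - cos u * sqrt m, so
    dy = sqrt m dx - cos u * sqrt m dt, tau = t defines new coordinates, in which
    w = u + arctan u_x satisfies w_{y tau} = sin w.  The four laws are the
    sine-Gordon laws with densities cos w - 1, w_y^2 / 2,
    (w_y^4 - 4 w_yy^2) / 8 and (w_y^6 - 20 w_y^2 w_yy^2 + 8 w_yyy^2) / 16,
    pulled back to (x, t); the third and fourth have fluxes that vanish at
    infinity.  The first flux involves w_tau, which is identified with the
    nonlocal term by showing that u_t tends to 0 at minus infinity. *)

(** Expanding (sin u)_xx turns the equation into u_xt + cos u * u_xx = m * sin u. Hence the
    derivation d/dtau = d/dt + cos u * d/dx sends arctan u_x to sin u, so that w_tau = u_t + sin u +
    (sin u)_x. By the equation, the x-derivative of this is sin u + (sin u)_x = sqrt m * sin w. This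
    is why w is the right variable. Neither y, tau nor arctan is ever constructed: w enters only
    through sin w, cos w and its y-derivatives, all written explicitly in u and its x-derivatives.
    The obstacle is then large identities with half-integer powers of m. Each of these functions is
    a rational expression times at most one factor 1 / sqrt m. That factor is kept as the
    indivisible symbol [inv_metric], whose square is rational, so that [field] can decide the
    identities. *)

(** * Limits and improper integrals *)

Lemma is_lim_mult_finite (f g : R -> R) (x : Rbar) (lf lg : R) :
  is_lim f x lf -> is_lim g x lg -> is_lim (fun y => f y * g y) x (lf * lg).
Proof.
  intros Hf Hg.
  exact (is_lim_mult f g x lf lg Hf Hg I).
Qed.

Lemma is_lim_pow_finite (f : R -> R) (x : Rbar) (l : R) (n : nat) :
  is_lim f x l -> is_lim (fun y => f y ^ n) x (l ^ n).
Proof.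
  intros Hf; induction n as [|n IH]; simpl.
  - apply is_lim_const.
  - now apply is_lim_mult_finite.
Qed.

Lemma is_lim_inv_finite (f : R -> R) (x : Rbar) (l : R) :
  l <> 0 -> is_lim f x l -> is_lim (fun y => / f y) x (/ l).
Proof.
  intros Hl Hf.
  apply (is_lim_inv f x l Hf).
  now intros E; injection E.
Qed.

Lemma is_lim_opp_finite (f : R -> R) (x : Rbar) (l : R) :
  is_lim f x l -> is_lim (fun y => - f y) x (- l).
Proof. exact (is_lim_opp f x l). Qed.

Lemma is_RInt_gen_antiderivative (F f : R -> R) (l1 l2 : R) :
  (forall x, is_derive F x (f x)) -> (forall x, continuous f x) ->
  is_lim F m_infty l1 -> is_lim F p_infty l2 ->
  is_RInt_gen f (Rbar_locally m_infty) (Rbar_locally p_infty) (l2 - l1).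
Proof.
  intros HF Hf H1 H2.
  apply (is_RInt_gen_ext (Derive F)).
  - apply filter_forall; intros ab x _.
    now apply is_derive_unique.
  - apply is_RInt_gen_Derive.
    + apply filter_forall; intros ab x _; eexists; apply HF.
    + apply filter_forall; intros ab x _.
      apply (continuous_ext f); [|apply Hf].
      intros y; symmetry; now apply is_derive_unique.
    + exact H1.
    + exact H2.
Qed.

Lemma RInt_gen_left_eventually (f : R -> R) (x l : R) (eps : posreal) :
  is_RInt_gen f (Rbar_locally m_infty) (at_point x) l ->
  exists M, forall y, y < M -> exists I, is_RInt f y x I /\ Rabs (I - l) < eps.
Proof.
  intros H.
  pose proof (proj1 (filterlimi_locally _ _) H eps) as HE.
  destruct HE as [P Q [M HM] HQ HPQ].
  exists M; intros y Hy.
  destruct (HPQ y x (HM y Hy) HQ) as [I [HI HB]].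
  exists I; split; [exact HI | exact HB].
Qed.

Lemma is_lim_m_infty_eventually (f : R -> R) (l : R) (eps : posreal) :
  is_lim f m_infty l -> exists M, forall y, y < M -> Rabs (f y - l) < eps.
Proof.
  intros H; apply is_lim_spec in H; exact (H eps).
Qed.

(** F y = F x minus the integral of f from y to x, so convergence of the integral produces a limit
    of F. It serves for w_tau, which contains u_t, a function on which the decay hypotheses impose
    no limit. *)
Lemma is_lim_antiderivative_m_infty (F f : R -> R) (x l : R) :
  (forall y, is_derive F y (f y)) -> (forall y, continuous f y) ->
  is_RInt_gen f (Rbar_locally m_infty) (at_point x) l ->
  is_lim F m_infty (F x - l).
Proof.
  intros HF Hf Hl; apply is_lim_spec; intros eps.
  destruct (RInt_gen_left_eventually f x l eps Hl) as [M HM].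
  exists M; intros y Hy.
  destruct (HM y Hy) as [I [HI HB]].
  assert (E : I = F x - F y).
  { rewrite <- (is_RInt_unique _ _ _ _ HI).
    apply is_RInt_unique.
    apply (is_RInt_derive F f y x); intros z _; [apply HF | apply Hf]. }
  replace (F y - (F x - l)) with (- (I - l)) by (rewrite E; ring).
  now rewrite Rabs_Ropp.
Qed.

(** Far to the left, the integral over a unit interval [y - 1, y] is a difference of two nearly
    equal tails, hence small; but it is also close to l. *)
Lemma ex_RInt_gen_limit_zero (f : R -> R) (x l : R) :
  ex_RInt_gen f (Rbar_locally m_infty) (at_point x) ->
  is_lim f m_infty l -> l = 0.
Proof.
  intros [J HJ] Hl.
  destruct (Req_dec l 0) as [|Hl0]; [assumption|exfalso].
  (* Each tail costs at most eps, and so does replacing f by l on the unit interval. Together they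
     give |l| < 3 * eps, which eps = |l| / 4 contradicts. *)
  assert (Hpos : 0 < Rabs l / 4) by (pose proof (Rabs_pos_lt l Hl0); lra).
  set (eps := mkposreal _ Hpos).
  destruct (RInt_gen_left_eventually f x J eps HJ) as [M1 HM1].
  destruct (is_lim_m_infty_eventually f l eps Hl) as [M2 HM2].
  set (y := Rmin M1 M2 - 1).
  assert (Hy : y < M1 /\ y < M2).
  { unfold y; pose proof (Rmin_l M1 M2); pose proof (Rmin_r M1 M2); lra. }
  clearbody y; destruct Hy as [Hy1 Hy2].
  destruct (HM1 y Hy1) as [I1 [HI1 HB1]].
  destruct (HM1 (y - 1)) as [I2 [HI2 HB2]]; [lra|].
  assert (HI : is_RInt f (y - 1) y (I2 - I1)).
  { apply (is_RInt_Chasles f (y - 1) x y I2 (- I1)); [exact HI2|].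
    now apply (is_RInt_swap f). }
  assert (HD : is_RInt (fun z => f z - l) (y - 1) y (I2 - I1 - l)).
  { replace (I2 - I1 - l) with (minus (I2 - I1) (scal (y - (y - 1)) l)).
    - apply (@is_RInt_minus R_NormedModule); [exact HI|].
      apply (@is_RInt_const R_NormedModule).
    - unfold minus, plus, opp, scal; simpl; unfold mult; simpl; ring. }
  assert (HN : Rabs (I2 - I1 - l) <= (y - (y - 1)) * eps).
  { apply (norm_RInt_le_const (fun z => f z - l) (y - 1) y _ eps);
      [lra | | exact HD].
    intros z Hz; apply Rlt_le, (HM2 z); lra. }
  simpl in HN, HB1, HB2.
  apply Rabs_def2 in HB1; apply Rabs_def2 in HB2.
  revert HN HB1 HB2; unfold Rabs; repeat destruct Rcase_abs; intros; lra.
Qed.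

Lemma is_derive_zero_conserved (H : R -> R) :
  (forall t, 0 < t -> is_derive H t 0) -> conserved H.
Proof.
  intros HH.
  assert (L : forall a b, 0 < a -> a < b -> H a = H b).
  { intros a b Ha Hab; apply eq_is_derive; [|exact Hab].
    intros t Ht; apply HH; lra. }
  intros t1 t2 H1 H2.
  destruct (Rtotal_order t1 t2) as [h|[->|h]].
  - now apply L.
  - reflexivity.
  - symmetry; now apply L.
Qed.

(** * Conservation laws and their fluxes *)

(** The common value [d] of D_t and F_x is explicit because the conserved integrals need its
    continuity in x in order to integrate it over the line. *)
Definition local_law (D F d : R -> R -> R) : Prop :=
  forall x t, 0 < t ->
    is_derive (fun s => D x s) t (d x t)
    /\ is_derive (fun y => F y t) x (d x t).

Lemma locally_positive (t : R) : 0 < t -> locally t (fun s => 0 < s).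
Proof. intros Ht; apply (open_gt 0 t Ht). Qed.

Lemma local_law_density_ext (D F d T : R -> R -> R) :
  local_law D F d -> (forall x t, 0 < t -> T x t = D x t) -> local_law T F d.
Proof.
  intros L E x t Ht; split; [|now apply L].
  (* The two densities agree only at positive times, which form a neighbourhood of t. *)
  apply is_derive_ext_loc with (fun s => D x s); [|now apply L].
  apply (filter_imp (fun s => 0 < s)); [|now apply locally_positive].
  intros s Hs; symmetry; now apply E.
Qed.

Lemma local_law_conservation_law (D F d X : R -> R -> R) :
  local_law D F d -> (forall x t, 0 < t -> X x t = F x t) ->
  conservation_law D X.
Proof.
  intros L EX x t Ht.
  destruct (L x t Ht) as [HT HF].
  assert (HX : is_derive (fun y => X y t) x (d x t)).
  { apply is_derive_ext with (fun y => F y t); [|exact HF].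
    intros y; symmetry; now apply EX. }
  split; [eexists; exact HT|split; [eexists; exact HX|]].
  transitivity (d x t); [|symmetry]; now apply is_derive_unique.
Qed.

(** Under the integral sign D_t = F_x, so the time derivative of the integral is the difference l -
    l of the limits of the flux. *)
Lemma local_law_conserved (D F d : R -> R -> R) (l : R) :
  local_law D F d ->
  (forall x t, 0 < t -> continuous (fun y => d y t) x) ->
  (forall t, 0 < t -> is_lim (fun x => F x t) m_infty l
                      /\ is_lim (fun x => F x t) p_infty l) ->
  diff_under_int_R D ->
  conserved (fun t => int_R (fun x => D x t)).
Proof.
  intros L Hd HF HD; apply is_derive_zero_conserved; intros t Ht.
  destruct (HD t Ht) as [_ H].
  replace 0 with (int_R (fun x => pdt D x t)); [exact H|].
  apply (is_RInt_gen_unique (fun x => pdt D x t) 0).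
  apply (is_RInt_gen_ext (fun x => d x t)).
  { apply filter_forall; intros ab x _; symmetry.
    apply is_derive_unique; now apply L. }
  replace 0 with (l - l) by ring.
  apply is_RInt_gen_antiderivative with (fun x => F x t).
  - intros x; now apply L.
  - intros x; now apply Hd.
  - now apply HF.
  - now apply HF.
Qed.

(* Densities and fluxes transform this way under the change of variables
   dy = h dx - c h dt: the law E_tau = G_y for E becomes
   (h E)_t = (G - c h E)_x, where d/dy = (1/h) d/dx and d/dtau = d/dt + c d/dx. *)
Lemma reciprocal_local_law
  (h c E G e hx cx Ex : R -> R -> R) :
  (forall x t, 0 < t -> is_derive (fun y => h y t) x (hx x t)) ->
  (forall x t, 0 < t ->
     is_derive (fun s => h x s) t (- (cx x t * h x t + c x t * hx x t))) ->
  (forall x t, 0 < t -> is_derive (fun y => c y t) x (cx x t)) ->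
  (forall x t, 0 < t -> is_derive (fun y => E y t) x (Ex x t)) ->
  (forall x t, 0 < t -> is_derive (fun s => E x s) t (e x t - c x t * Ex x t)) ->
  (forall x t, 0 < t -> is_derive (fun y => G y t) x (h x t * e x t)) ->
  local_law (fun x t => h x t * E x t)
    (fun x t => G x t - c x t * (h x t * E x t))
    (fun x t => h x t * e x t
       - (cx x t * (h x t * E x t)
          + c x t * (hx x t * E x t + h x t * Ex x t))).
Proof.
  intros Hhx Hht Hc HEx HEt HG x t Ht.
  specialize (Hhx x t Ht); specialize (Hht x t Ht); specialize (Hc x t Ht).
  specialize (HEx x t Ht); specialize (HEt x t Ht); specialize (HG x t Ht).
  split.
  - evar_last.
    + apply (is_derive_mult (fun s => h x s) (fun s => E x s) t _ _ Hht HEt).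
      intros; apply Rmult_comm.
    + unfold plus, mult; simpl; ring.
  - evar_last.
    + apply (is_derive_minus (fun y => G y t)); [exact HG|].
      apply (is_derive_mult (fun y => c y t) (fun y => h y t * E y t)).
      * exact Hc.
      * apply (is_derive_mult (fun y => h y t) (fun y => E y t)).
        -- exact Hhx.
        -- exact HEx.
        -- intros; apply Rmult_comm.
      * intros; apply Rmult_comm.
    + unfold minus, plus, opp, mult; simpl; ring.
Qed.

(** * The sine-Gordon variable and its derivatives *)

Ltac derive_along :=
  auto_derive;
  [ repeat split; try exact I; try (eexists; eassumption)
  | repeat match goal with
    | H : is_derive ?f ?s ?d |- context [Derive ?g ?s] =>
        replace (Derive g s) with d
          by (symmetry; apply is_derive_unique; exact H)
    end ].

(** The factor 1 / sqrt m with p = u_x, which is also cos (arctan p). It is the only irrational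
    function of p in the computations. *)
Definition inv_metric (p : R) : R := / sqrt (1 + p ^ 2).

Lemma one_plus_square_pos (p : R) : 0 < 1 + p ^ 2.
Proof. pose proof (pow2_ge_0 p); lra. Qed.

Lemma sqrt_one_plus_square_pos (p : R) : 0 < sqrt (1 + p ^ 2).
Proof. apply sqrt_lt_R0, one_plus_square_pos. Qed.

Lemma inv_metric_square (p : R) : inv_metric p ^ 2 = / (1 + p ^ 2).
Proof.
  unfold inv_metric; rewrite pow_inv, pow2_sqrt; [reflexivity|].
  apply Rlt_le, one_plus_square_pos.
Qed.

Lemma sqrt_inv_metric (p : R) : sqrt (1 + p ^ 2) = (1 + p ^ 2) * inv_metric p.
Proof.
  pose proof (one_plus_square_pos p) as Hm.
  pose proof (sqrt_one_plus_square_pos p) as Hs.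
  unfold inv_metric; apply Rmult_eq_reg_r with (sqrt (1 + p ^ 2)); [|lra].
  rewrite sqrt_sqrt; [field; lra | lra].
Qed.

(* With w = u + arctan u_x and d/dy = (1/sqrt m) d/dx, the functions below
   express sqrt m, w_y, w_yy, w_yyy, w_yyyy, sin w and cos w through
   z = u, p = u_x, q = u_xx, r = u_xxx, a = u_xxxx, b = u_xxxxx. *)

Definition sg_h (p : R) : R := (1 + p ^ 2) * inv_metric p.

Definition sg_v (p q : R) : R := (p + q / (1 + p ^ 2)) * inv_metric p.

Definition sg_v1 (p q r : R) : R :=
  ((1 + p ^ 2) * (q + r) - 3 * p * q ^ 2) / (1 + p ^ 2) ^ 3.

Definition sg_v2 (p q r a : R) : R :=
  ((1 + p ^ 2) ^ 2 * (r + a)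
   + (1 + p ^ 2) * (- 4 * p * q ^ 2 - 10 * p * q * r + 15 * q ^ 3)
   - 18 * q ^ 3) / (1 + p ^ 2) ^ 4 * inv_metric p.

Definition sg_v3 (p q r a b : R) : R :=
  ((1 + p ^ 2) ^ 2 * b
   + ((1 + p ^ 2) ^ 2 * a + 4 * p * q * (1 + p ^ 2) * (r + a)
      + 2 * p * q * (- 4 * p * q ^ 2 - 10 * p * q * r + 15 * q ^ 3)
      + (1 + p ^ 2) * (- 4 * q ^ 3 - 8 * p * q * r - 10 * q ^ 2 * r
                       - 10 * p * r ^ 2 - 10 * p * q * a + 45 * q ^ 2 * r)
      - 54 * q ^ 2 * r)) / (1 + p ^ 2) ^ 5
  - 9 * p * q
    * ((1 + p ^ 2) ^ 2 * (r + a)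
       + (1 + p ^ 2) * (- 4 * p * q ^ 2 - 10 * p * q * r + 15 * q ^ 3)
       - 18 * q ^ 3) / (1 + p ^ 2) ^ 6.

Definition sg_sin (z p : R) : R := (sin z + p * cos z) * inv_metric p.

Definition sg_cos (z p : R) : R := (cos z - p * sin z) * inv_metric p.

Lemma is_derive_inv_metric (p : R) :
  is_derive inv_metric p (- (p / (1 + p ^ 2) * inv_metric p)).
Proof.
  pose proof (one_plus_square_pos p) as Hm.
  pose proof (sqrt_one_plus_square_pos p) as Hs.
  evar_last.
  - apply is_derive_inv with (f := fun y => sqrt (1 + y ^ 2)); [|lra].
    apply (is_derive_sqrt (fun y => 1 + y ^ 2)); [|exact Hm].
    instantiate (1 := 2 * p).
    auto_derive; [exact I | ring].
  - rewrite pow2_sqrt by lra.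
    unfold inv_metric; field; split; lra.
Qed.

Lemma inv_metric_mult (p a b : R) :
  (a * inv_metric p) * (b * inv_metric p) = a * b / (1 + p ^ 2).
Proof.
  replace (a * inv_metric p * (b * inv_metric p)) with (a * b * inv_metric p ^ 2)
    by ring.
  now rewrite inv_metric_square.
Qed.

(** Differentiates with [inv_metric] as an opaque function and then merges products of two copies of
    it into 1 / (1 + p ^ 2). At most one copy is left in each term, and [field] treats it as an
    atom. *)
Ltac derive_sg Hp :=
  match type of Hp with is_derive ?p ?s _ =>
    pose proof (is_derive_inv_metric (p s));
    pose proof (one_plus_square_pos (p s)) as Hm; cbv beta in Hm
  end;
  derive_along;
  [ repeat apply Rmult_integral_contrapositive_currified; lra ..
  | rewrite ?inv_metric_mult ].

Lemma is_derive_sg_h (p : R -> R) (s dp : R) :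
  is_derive p s dp ->
  is_derive (fun y => sg_h (p y)) s (p s * dp * inv_metric (p s)).
Proof.
  intros Hp; unfold sg_h; derive_sg Hp.
  field; lra.
Qed.

Lemma is_derive_sg_v_x (p q : R -> R) (s r : R) :
  is_derive p s (q s) -> is_derive q s r ->
  is_derive (fun y => sg_v (p y) (q y)) s (sg_h (p s) * sg_v1 (p s) (q s) r).
Proof.
  intros Hp Hq; unfold sg_v, sg_h, sg_v1; derive_sg Hp.
  field; lra.
Qed.

Lemma is_derive_sg_v1_x (p q r : R -> R) (s a : R) :
  is_derive p s (q s) -> is_derive q s (r s) -> is_derive r s a ->
  is_derive (fun y => sg_v1 (p y) (q y) (r y)) s
    (sg_h (p s) * sg_v2 (p s) (q s) (r s) a).
Proof.
  intros Hp Hq Hr; unfold sg_v2, sg_h, sg_v1; derive_sg Hp.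
  field; lra.
Qed.

Lemma is_derive_sg_v2_x (p q r a : R -> R) (s b : R) :
  is_derive p s (q s) -> is_derive q s (r s) -> is_derive r s (a s) ->
  is_derive a s b ->
  is_derive (fun y => sg_v2 (p y) (q y) (r y) (a y)) s
    (sg_h (p s) * sg_v3 (p s) (q s) (r s) (a s) b).
Proof.
  intros Hp Hq Hr Ha; unfold sg_v2, sg_h, sg_v3; derive_sg Hp.
  field; lra.
Qed.

Lemma is_derive_sg_sin_x (z p : R -> R) (s q : R) :
  is_derive z s (p s) -> is_derive p s q ->
  is_derive (fun y => sg_sin (z y) (p y)) s
    (sg_h (p s) * (sg_v (p s) q * sg_cos (z s) (p s))).
Proof.
  intros Hz Hp; unfold sg_sin, sg_cos, sg_v, sg_h; derive_sg Hp.
  field; lra.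
Qed.

Lemma is_derive_sg_cos (z p : R -> R) (s dz dp : R) :
  is_derive z s dz -> is_derive p s dp ->
  is_derive (fun y => sg_cos (z y) (p y)) s
    (- ((dz + dp / (1 + p s ^ 2)) * sg_sin (z s) (p s))).
Proof.
  intros Hz Hp; unfold sg_sin, sg_cos; derive_sg Hp.
  field; lra.
Qed.

(* The right-hand side of the equation and its first three x-derivatives, in
   terms of z = u, p = u_x, q = u_xx, ... *)

Definition rhs_xt (z p q : R) : R := (1 + p ^ 2) * sin z - q * cos z.

Definition rhs_xxt (z p q r : R) : R :=
  3 * p * q * sin z + ((1 + p ^ 2) * p - r) * cos z.

Definition rhs_xxxt (z p q r a : R) : R :=
  (3 * q ^ 2 + 4 * p * r - (1 + p ^ 2) * p ^ 2) * sin z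
  + (5 * p ^ 2 * q + (1 + p ^ 2) * q - a) * cos z.

Definition rhs_xxxxt (z p q r a b : R) : R :=
  (10 * q * r + 5 * p * a - 7 * p ^ 3 * q - 3 * (1 + p ^ 2) * p * q) * sin z
  + (15 * p * q ^ 2 + 9 * p ^ 2 * r - (1 + p ^ 2) * p ^ 3
     + (1 + p ^ 2) * r - b) * cos z.

Lemma is_derive_rhs_xt (z p q : R -> R) (s r : R) :
  is_derive z s (p s) -> is_derive p s (q s) -> is_derive q s r ->
  is_derive (fun y => rhs_xt (z y) (p y) (q y)) s (rhs_xxt (z s) (p s) (q s) r).
Proof. intros Hz Hp Hq; unfold rhs_xt, rhs_xxt; derive_along; ring. Qed.

Lemma is_derive_rhs_xxt (z p q r : R -> R) (s a : R) :
  is_derive z s (p s) -> is_derive p s (q s) -> is_derive q s (r s) ->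
  is_derive r s a ->
  is_derive (fun y => rhs_xxt (z y) (p y) (q y) (r y)) s
    (rhs_xxxt (z s) (p s) (q s) (r s) a).
Proof. intros Hz Hp Hq Hr; unfold rhs_xxt, rhs_xxxt; derive_along; ring. Qed.

Lemma is_derive_rhs_xxxt (z p q r a : R -> R) (s b : R) :
  is_derive z s (p s) -> is_derive p s (q s) -> is_derive q s (r s) ->
  is_derive r s (a s) -> is_derive a s b ->
  is_derive (fun y => rhs_xxxt (z y) (p y) (q y) (r y) (a y)) s
    (rhs_xxxxt (z s) (p s) (q s) (r s) (a s) b).
Proof. intros Hz Hp Hq Hr Ha; unfold rhs_xxxt, rhs_xxxxt; derive_along; ring. Qed.

(** This is w_ytau = sin w: since d/dt = d/dtau - cos u * d/dx, the subtracted term is the transport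
    part cos u * (w_y)_x. The next two lemmas are its first two y-derivatives, with right-hand sides
    (sin w)_y = w_y * cos w and (w_y * cos w)_y = w_yy * cos w - w_y ^ 2 * sin w. *)
Lemma is_derive_sg_v_t (p q : R -> R) (s z r : R) :
  is_derive p s (rhs_xt z (p s) (q s)) ->
  is_derive q s (rhs_xxt z (p s) (q s) r) ->
  is_derive (fun y => sg_v (p y) (q y)) s
    (sg_sin z (p s) - cos z * (sg_h (p s) * sg_v1 (p s) (q s) r)).
Proof.
  intros Hp Hq; unfold sg_v, sg_h, sg_v1, sg_sin; derive_sg Hp.
  unfold rhs_xt, rhs_xxt; field; lra.
Qed.

Lemma is_derive_sg_v1_t (p q r : R -> R) (s z a : R) :
  is_derive p s (rhs_xt z (p s) (q s)) ->
  is_derive q s (rhs_xxt z (p s) (q s) (r s)) ->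
  is_derive r s (rhs_xxxt z (p s) (q s) (r s) a) ->
  is_derive (fun y => sg_v1 (p y) (q y) (r y)) s
    (sg_v (p s) (q s) * sg_cos z (p s)
     - cos z * (sg_h (p s) * sg_v2 (p s) (q s) (r s) a)).
Proof.
  intros Hp Hq Hr; unfold sg_v, sg_h, sg_v1, sg_v2, sg_cos; derive_sg Hp.
  unfold rhs_xt, rhs_xxt, rhs_xxxt; field; lra.
Qed.

Lemma is_derive_sg_v2_t (p q r a : R -> R) (s z b : R) :
  is_derive p s (rhs_xt z (p s) (q s)) ->
  is_derive q s (rhs_xxt z (p s) (q s) (r s)) ->
  is_derive r s (rhs_xxxt z (p s) (q s) (r s) (a s)) ->
  is_derive a s (rhs_xxxxt z (p s) (q s) (r s) (a s) b) ->
  is_derive (fun y => sg_v2 (p y) (q y) (r y) (a y)) s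
    (sg_v1 (p s) (q s) (r s) * sg_cos z (p s)
     - sg_v (p s) (q s) * sg_v (p s) (q s) * sg_sin z (p s)
     - cos z * (sg_h (p s) * sg_v3 (p s) (q s) (r s) (a s) b)).
Proof.
  intros Hp Hq Hr Ha.
  unfold sg_v, sg_h, sg_v1, sg_v2, sg_v3, sg_sin, sg_cos; derive_sg Hp.
  unfold rhs_xt, rhs_xxt, rhs_xxxt, rhs_xxxxt; field; lra.
Qed.

(** * Derivatives of a solution *)

Lemma continuity_2d_pt_section (f : R -> R -> R) (x t : R) :
  continuity_2d_pt f x t -> continuous (fun y => f y t) x.
Proof.
  intros H; apply filterlim_locally; intros eps.
  destruct (H eps) as [d Hd]; exists d; intros y Hy.
  apply Hd; [exact Hy|].
  rewrite Rminus_diag, Rabs_R0; apply cond_pos.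
Qed.

Lemma continuity_2d_pt_pow (f : R -> R -> R) (n : nat) (x t : R) :
  continuity_2d_pt f x t -> continuity_2d_pt (fun y s => f y s ^ n) x t.
Proof.
  intros H; induction n as [|n IH]; simpl.
  - apply continuity_2d_pt_const.
  - now apply continuity_2d_pt_mult.
Qed.

Lemma continuity_2d_pt_sin (f : R -> R -> R) (x t : R) :
  continuity_2d_pt f x t -> continuity_2d_pt (fun y s => sin (f y s)) x t.
Proof. apply continuity_1d_2d_pt_comp, continuity_sin. Qed.

Lemma continuity_2d_pt_cos (f : R -> R -> R) (x t : R) :
  continuity_2d_pt f x t -> continuity_2d_pt (fun y s => cos (f y s)) x t.
Proof. apply continuity_1d_2d_pt_comp, continuity_cos. Qed.

Lemma continuity_2d_pt_inv_metric (f : R -> R -> R) (x t : R) :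
  continuity_2d_pt f x t ->
  continuity_2d_pt (fun y s => inv_metric (f y s)) x t.
Proof.
  apply continuity_1d_2d_pt_comp, continuity_pt_filterlim.
  apply (ex_derive_continuous inv_metric); eexists; apply is_derive_inv_metric.
Qed.

Ltac continuous_2d :=
  repeat first
    [ assumption
    | apply continuity_2d_pt_inv_metric
    | apply continuity_2d_pt_plus | apply continuity_2d_pt_minus
    | apply continuity_2d_pt_mult | apply continuity_2d_pt_inv
    | apply continuity_2d_pt_opp | apply continuity_2d_pt_pow
    | apply continuity_2d_pt_sin | apply continuity_2d_pt_cos
    | apply continuity_2d_pt_const ].

Lemma is_derive_pdx (u : R -> R -> R) (n : nat) (x t : R) :
  sufficiently_smooth u -> (n <= 4)%nat -> 0 < t ->
  is_derive (fun y => pdx n u y t) x (pdx (S n) u x t).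
Proof.
  intros [H _] Hn Ht; apply Derive_correct.
  exact (proj1 (H (S n) ltac:(lia)) x t Ht).
Qed.

Lemma continuity_2d_pt_pdx (u : R -> R -> R) (n : nat) (x t : R) :
  sufficiently_smooth u -> (n <= 5)%nat -> 0 < t ->
  continuity_2d_pt (pdx n u) x t.
Proof. intros [H _] Hn Ht; now apply H. Qed.

Lemma locally_2d_positive (x t : R) :
  0 < t -> locally_2d (fun _ s => 0 < s) x t.
Proof.
  intros Ht; exists (mkposreal t Ht); intros y s _ Hs; simpl in Hs.
  apply Rabs_def2 in Hs; lra.
Qed.

(* Equality of mixed derivatives promotes a formula g for u_{x..xt} to the
   formula g_x for the next one. *)
Lemma is_derive_t_pdx_succ (u g g' : R -> R -> R) (n : nat) :
  sufficiently_smooth u -> (n <= 3)%nat ->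
  (forall x t, 0 < t -> is_derive (fun s => pdx n u x s) t (g x t)) ->
  (forall x t, 0 < t -> is_derive (fun y => g y t) x (g' x t)) ->
  continuous_xt g' ->
  forall x t, 0 < t -> is_derive (fun s => pdx (S n) u x s) t (g' x t).
Proof.
  intros Hu Hn Hg Hg' Hc x t Ht.
  assert (Hgt : forall y s, 0 < s ->
    is_derive (fun z => Derive (fun s' => pdx n u z s') s) y (g' y s)).
  { intros y s Hs; apply is_derive_ext with (fun z => g z s).
    - intros z; symmetry; apply is_derive_unique; now apply Hg.
    - now apply Hg'. }
  destruct (proj1 (proj2 Hu) (S n) ltac:(lia)) as [Hex Hcont].
  replace (g' x t) with (Derive (fun s => pdx (S n) u x s) t);
    [now apply Derive_correct, Hex|].
  rewrite <- (is_derive_unique _ _ _ (Hgt x t Ht)).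
  symmetry; apply (Schwarz (pdx n u)).
  - destruct (locally_2d_positive x t Ht) as [d Hd]; exists d.
    intros y s Hy Hs; specialize (Hd y s Hy Hs).
    split; [eexists; apply is_derive_pdx; auto; lia|].
    split; [eexists; now apply Hg|].
    split; [eexists; now apply Hgt|].
    now apply Hex.
  - apply continuity_2d_pt_ext_loc with g'; [|now apply Hc].
    destruct (locally_2d_positive x t Ht) as [d Hd]; exists d.
    intros y s Hy Hs; symmetry; apply is_derive_unique, Hgt.
    now apply (Hd y s).
  - now apply Hcont.
Qed.

Lemma is_derive_u (u : R -> R -> R) (x t : R) :
  sufficiently_smooth u -> 0 < t ->
  is_derive (fun y => u y t) x (pdx 1 u x t).
Proof. intros Hu; apply (is_derive_pdx u 0 x t Hu); lia. Qed.

Lemma continuity_2d_pt_u (u : R -> R -> R) (x t : R) :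
  sufficiently_smooth u -> 0 < t -> continuity_2d_pt u x t.
Proof. intros Hu; apply (continuity_2d_pt_pdx u 0 x t Hu); lia. Qed.

Ltac smooth_jets :=
  cbv beta;
  lazymatch goal with
  | |- continuity_2d_pt (pdx ?n ?u) _ _ =>
      apply (continuity_2d_pt_pdx u n); [assumption | lia | assumption]
  | |- continuity_2d_pt ?u _ _ => apply (continuity_2d_pt_u u); assumption
  | |- is_derive (fun y => pdx ?n ?u y _) _ _ =>
      apply (is_derive_pdx u n); [assumption | lia | assumption]
  | |- is_derive (fun y => ?u y _) _ _ => apply (is_derive_u u); assumption
  end.

Lemma is_derive_t_u (u : R -> R -> R) (x t : R) :
  sufficiently_smooth u -> 0 < t ->
  is_derive (fun s => u x s) t (pdt u x t).
Proof.
  intros Hu Ht; apply Derive_correct.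
  exact (proj1 (proj1 (proj2 Hu) 0%nat ltac:(lia)) x t Ht).
Qed.

Lemma is_derive_sin_comp (f : R -> R) (s d : R) :
  is_derive f s d -> is_derive (fun y => sin (f y)) s (cos (f s) * d).
Proof. intros H; derive_along; ring. Qed.

Lemma is_derive_cos_comp (f : R -> R) (s d : R) :
  is_derive f s d -> is_derive (fun y => cos (f y)) s (- sin (f s) * d).
Proof. intros H; derive_along; ring. Qed.

Lemma pdx_sinu (u : R -> R -> R) (x t : R) :
  sufficiently_smooth u -> 0 < t ->
  pdx 1 (sinu u) x t = cos (u x t) * pdx 1 u x t.
Proof.
  intros Hu Ht; apply is_derive_unique.
  apply (is_derive_sin_comp (fun y => u y t)); now apply is_derive_u.
Qed.

Lemma pdx_cosu (u : R -> R -> R) (x t : R) :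
  sufficiently_smooth u -> 0 < t ->
  pdx 1 (cosu u) x t = - sin (u x t) * pdx 1 u x t.
Proof.
  intros Hu Ht; apply is_derive_unique.
  apply (is_derive_cos_comp (fun y => u y t)); now apply is_derive_u.
Qed.

Lemma is_derive_cos_mult (z p : R -> R) (s dz dp : R) :
  is_derive z s dz -> is_derive p s dp ->
  is_derive (fun y => cos (z y) * p y) s
    (- sin (z s) * dz * p s + cos (z s) * dp).
Proof. intros Hz Hp; derive_along; ring. Qed.

Lemma pdx2_sinu (u : R -> R -> R) (x t : R) :
  sufficiently_smooth u -> 0 < t ->
  pdx 2 (sinu u) x t
  = - sin (u x t) * pdx 1 u x t * pdx 1 u x t + cos (u x t) * pdx 2 u x t.
Proof.
  intros Hu Ht; apply is_derive_unique.
  apply is_derive_ext with (fun y => cos (u y t) * pdx 1 u y t).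
  - intros y; symmetry; now apply pdx_sinu.
  - apply (is_derive_cos_mult (fun y => u y t) (fun y => pdx 1 u y t)).
    + now apply is_derive_u.
    + apply is_derive_pdx; auto; lia.
Qed.

Lemma pdx_m_of (u : R -> R -> R) (x t : R) :
  sufficiently_smooth u -> 0 < t ->
  pdx 1 (m_of u) x t = 2 * pdx 1 u x t * pdx 2 u x t.
Proof.
  intros Hu Ht; apply is_derive_unique; unfold m_of.
  assert (H : is_derive (fun y => pdx 1 u y t) x (pdx 2 u x t))
    by (apply is_derive_pdx; auto; lia).
  set (p := fun y => pdx 1 u y t) in H.
  change (is_derive (fun y => 1 + p y ^ 2) x (2 * p x * pdx 2 u x t)).
  derive_along; ring.
Qed.

Lemma is_derive_x_pdt_u (u : R -> R -> R) (x t : R) :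
  sufficiently_smooth u -> generalized_sine_Gordon u -> 0 < t ->
  is_derive (fun y => pdt u y t) x
    (rhs_xt (u x t) (pdx 1 u x t) (pdx 2 u x t)).
Proof.
  intros Hu Heq Ht.
  replace (rhs_xt (u x t) (pdx 1 u x t) (pdx 2 u x t)) with (pdx 1 (pdt u) x t).
  - apply Derive_correct; now apply Hu.
  - rewrite Heq, pdx2_sinu by assumption; unfold sinu, rhs_xt; ring.
Qed.

Lemma is_derive_t_pdx1 (u : R -> R -> R) :
  sufficiently_smooth u -> generalized_sine_Gordon u ->
  forall x t, 0 < t -> is_derive (fun s => pdx 1 u x s) t
    (rhs_xt (u x t) (pdx 1 u x t) (pdx 2 u x t)).
Proof.
  intros Hu Heq.
  (* The chain starts from u itself, [pdx 0 u], with the unknown function u_t as its time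
     derivative. From u_x on, the equation removes u_t from all formulas. *)
  apply (is_derive_t_pdx_succ u (pdt u)
    (fun x t => rhs_xt (u x t) (pdx 1 u x t) (pdx 2 u x t)) 0 Hu ltac:(lia)).
  - intros x t Ht; now apply is_derive_t_u.
  - intros x t Ht; now apply is_derive_x_pdt_u.
  - intros x t Ht; unfold rhs_xt; continuous_2d; smooth_jets.
Qed.

Lemma is_derive_t_pdx2 (u : R -> R -> R) :
  sufficiently_smooth u -> generalized_sine_Gordon u ->
  forall x t, 0 < t -> is_derive (fun s => pdx 2 u x s) t
    (rhs_xxt (u x t) (pdx 1 u x t) (pdx 2 u x t) (pdx 3 u x t)).
Proof.
  intros Hu Heq.
  apply (is_derive_t_pdx_succ u _
    (fun x t => rhs_xxt (u x t) (pdx 1 u x t) (pdx 2 u x t) (pdx 3 u x t))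
    1 Hu ltac:(lia) (is_derive_t_pdx1 u Hu Heq)).
  - intros x t Ht.
    apply (is_derive_rhs_xt (fun y => u y t) (fun y => pdx 1 u y t)
      (fun y => pdx 2 u y t));
      smooth_jets.
  - intros x t Ht; unfold rhs_xxt; continuous_2d; smooth_jets.
Qed.

Lemma is_derive_t_pdx3 (u : R -> R -> R) :
  sufficiently_smooth u -> generalized_sine_Gordon u ->
  forall x t, 0 < t -> is_derive (fun s => pdx 3 u x s) t
    (rhs_xxxt (u x t) (pdx 1 u x t) (pdx 2 u x t) (pdx 3 u x t) (pdx 4 u x t)).
Proof.
  intros Hu Heq.
  apply (is_derive_t_pdx_succ u _
    (fun x t => rhs_xxxt (u x t) (pdx 1 u x t) (pdx 2 u x t) (pdx 3 u x t)
       (pdx 4 u x t))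
    2 Hu ltac:(lia) (is_derive_t_pdx2 u Hu Heq)).
  - intros x t Ht.
    apply (is_derive_rhs_xxt (fun y => u y t) (fun y => pdx 1 u y t)
      (fun y => pdx 2 u y t) (fun y => pdx 3 u y t));
      smooth_jets.
  - intros x t Ht; unfold rhs_xxxt; continuous_2d; smooth_jets.
Qed.

Lemma is_derive_t_pdx4 (u : R -> R -> R) :
  sufficiently_smooth u -> generalized_sine_Gordon u ->
  forall x t, 0 < t -> is_derive (fun s => pdx 4 u x s) t
    (rhs_xxxxt (u x t) (pdx 1 u x t) (pdx 2 u x t) (pdx 3 u x t) (pdx 4 u x t)
       (pdx 5 u x t)).
Proof.
  intros Hu Heq.
  apply (is_derive_t_pdx_succ u _
    (fun x t => rhs_xxxxt (u x t) (pdx 1 u x t) (pdx 2 u x t) (pdx 3 u x t)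
       (pdx 4 u x t) (pdx 5 u x t))
    3 Hu ltac:(lia) (is_derive_t_pdx3 u Hu Heq)).
  - intros x t Ht.
    apply (is_derive_rhs_xxxt (fun y => u y t) (fun y => pdx 1 u y t)
      (fun y => pdx 2 u y t) (fun y => pdx 3 u y t) (fun y => pdx 4 u y t));
      smooth_jets.
  - intros x t Ht; unfold rhs_xxxxt; continuous_2d; smooth_jets.
Qed.

(** * Sine-Gordon quantities along a solution *)

Definition metric (u : R -> R -> R) (x t : R) : R := sg_h (pdx 1 u x t).

Definition metric_x (u : R -> R -> R) (x t : R) : R :=
  pdx 1 u x t * pdx 2 u x t * inv_metric (pdx 1 u x t).

Definition w_y (u : R -> R -> R) (x t : R) : R :=
  sg_v (pdx 1 u x t) (pdx 2 u x t).

Definition w_yy (u : R -> R -> R) (x t : R) : R :=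
  sg_v1 (pdx 1 u x t) (pdx 2 u x t) (pdx 3 u x t).

Definition w_yyy (u : R -> R -> R) (x t : R) : R :=
  sg_v2 (pdx 1 u x t) (pdx 2 u x t) (pdx 3 u x t) (pdx 4 u x t).

Definition w_yyyy (u : R -> R -> R) (x t : R) : R :=
  sg_v3 (pdx 1 u x t) (pdx 2 u x t) (pdx 3 u x t) (pdx 4 u x t) (pdx 5 u x t).

Definition sin_w (u : R -> R -> R) (x t : R) : R := sg_sin (u x t) (pdx 1 u x t).

Definition cos_w (u : R -> R -> R) (x t : R) : R := sg_cos (u x t) (pdx 1 u x t).

Lemma is_derive_x_metric (u : R -> R -> R) (x t : R) :
  sufficiently_smooth u -> 0 < t ->
  is_derive (fun y => metric u y t) x (metric_x u x t).
Proof.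
  intros Hu Ht; apply (is_derive_sg_h (fun y => pdx 1 u y t)); smooth_jets.
Qed.

Lemma is_derive_x_w_y (u : R -> R -> R) (x t : R) :
  sufficiently_smooth u -> 0 < t ->
  is_derive (fun y => w_y u y t) x (metric u x t * w_yy u x t).
Proof.
  intros Hu Ht.
  apply (is_derive_sg_v_x (fun y => pdx 1 u y t) (fun y => pdx 2 u y t));
    smooth_jets.
Qed.

Lemma is_derive_x_w_yy (u : R -> R -> R) (x t : R) :
  sufficiently_smooth u -> 0 < t ->
  is_derive (fun y => w_yy u y t) x (metric u x t * w_yyy u x t).
Proof.
  intros Hu Ht.
  apply (is_derive_sg_v1_x (fun y => pdx 1 u y t) (fun y => pdx 2 u y t)
    (fun y => pdx 3 u y t)); smooth_jets.
Qed.

Lemma is_derive_x_w_yyy (u : R -> R -> R) (x t : R) :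
  sufficiently_smooth u -> 0 < t ->
  is_derive (fun y => w_yyy u y t) x (metric u x t * w_yyyy u x t).
Proof.
  intros Hu Ht.
  apply (is_derive_sg_v2_x (fun y => pdx 1 u y t) (fun y => pdx 2 u y t)
    (fun y => pdx 3 u y t) (fun y => pdx 4 u y t)); smooth_jets.
Qed.

Lemma is_derive_x_sin_w (u : R -> R -> R) (x t : R) :
  sufficiently_smooth u -> 0 < t ->
  is_derive (fun y => sin_w u y t) x
    (metric u x t * (w_y u x t * cos_w u x t)).
Proof.
  intros Hu Ht.
  apply (is_derive_sg_sin_x (fun y => u y t) (fun y => pdx 1 u y t));
    smooth_jets.
Qed.

(** The right-hand side is w_x, its second term being the derivative of arctan u_x. *)
Lemma metric_mult_w_y (u : R -> R -> R) (x t : R) :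
  metric u x t * w_y u x t
  = pdx 1 u x t + pdx 2 u x t / (1 + pdx 1 u x t ^ 2).
Proof.
  unfold metric, w_y, sg_h, sg_v; rewrite inv_metric_mult.
  pose proof (one_plus_square_pos (pdx 1 u x t)); field; lra.
Qed.

(** The addition formula for w = u + arctan u_x, using cos (arctan p) = 1 / sqrt (1 + p ^ 2) and sin
    (arctan p) = p / sqrt (1 + p ^ 2). The right-hand side is sin u + (sin u)_x, the integrand of
    the nonlocal term; the cosine analogue below gives cos u + (cos u)_x. *)
Lemma metric_mult_sin_w (u : R -> R -> R) (x t : R) :
  metric u x t * sin_w u x t = sin (u x t) + pdx 1 u x t * cos (u x t).
Proof.
  unfold metric, sin_w, sg_h, sg_sin; rewrite inv_metric_mult.
  pose proof (one_plus_square_pos (pdx 1 u x t)); field; lra.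
Qed.

Lemma metric_mult_cos_w (u : R -> R -> R) (x t : R) :
  metric u x t * cos_w u x t = cos (u x t) - pdx 1 u x t * sin (u x t).
Proof.
  unfold metric, cos_w, sg_h, sg_cos; rewrite inv_metric_mult.
  pose proof (one_plus_square_pos (pdx 1 u x t)); field; lra.
Qed.

Lemma is_derive_x_cos_w (u : R -> R -> R) (x t : R) :
  sufficiently_smooth u -> 0 < t ->
  is_derive (fun y => cos_w u y t) x
    (- (metric u x t * w_y u x t * sin_w u x t)).
Proof.
  intros Hu Ht; rewrite metric_mult_w_y.
  apply (is_derive_sg_cos (fun y => u y t) (fun y => pdx 1 u y t));
    smooth_jets.
Qed.

(** The value is -(cos u * sqrt m)_x: the form sqrt m dx - cos u * sqrt m dt is closed, which is
    what makes y a coordinate. *)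
Lemma is_derive_t_metric (u : R -> R -> R) (x t : R) :
  sufficiently_smooth u -> generalized_sine_Gordon u -> 0 < t ->
  is_derive (fun s => metric u x s) t
    (- (- sin (u x t) * pdx 1 u x t * metric u x t
        + cos (u x t) * metric_x u x t)).
Proof.
  intros Hu Heq Ht; evar_last.
  - apply (is_derive_sg_h (fun s => pdx 1 u x s)).
    now apply is_derive_t_pdx1.
  - unfold metric, metric_x, sg_h, rhs_xt; ring.
Qed.

Lemma is_derive_t_w_y (u : R -> R -> R) (x t : R) :
  sufficiently_smooth u -> generalized_sine_Gordon u -> 0 < t ->
  is_derive (fun s => w_y u x s) t
    (sin_w u x t - cos (u x t) * (metric u x t * w_yy u x t)).
Proof.
  intros Hu Heq Ht.
  apply (is_derive_sg_v_t (fun s => pdx 1 u x s) (fun s => pdx 2 u x s)).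
  - now apply is_derive_t_pdx1.
  - now apply is_derive_t_pdx2.
Qed.

Lemma is_derive_t_w_yy (u : R -> R -> R) (x t : R) :
  sufficiently_smooth u -> generalized_sine_Gordon u -> 0 < t ->
  is_derive (fun s => w_yy u x s) t
    (w_y u x t * cos_w u x t
     - cos (u x t) * (metric u x t * w_yyy u x t)).
Proof.
  intros Hu Heq Ht.
  apply (is_derive_sg_v1_t (fun s => pdx 1 u x s) (fun s => pdx 2 u x s)
    (fun s => pdx 3 u x s)).
  - now apply is_derive_t_pdx1.
  - now apply is_derive_t_pdx2.
  - now apply is_derive_t_pdx3.
Qed.

Lemma is_derive_t_w_yyy (u : R -> R -> R) (x t : R) :
  sufficiently_smooth u -> generalized_sine_Gordon u -> 0 < t ->
  is_derive (fun s => w_yyy u x s) t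
    (w_yy u x t * cos_w u x t - w_y u x t * w_y u x t * sin_w u x t
     - cos (u x t) * (metric u x t * w_yyyy u x t)).
Proof.
  intros Hu Heq Ht.
  apply (is_derive_sg_v2_t (fun s => pdx 1 u x s) (fun s => pdx 2 u x s)
    (fun s => pdx 3 u x s) (fun s => pdx 4 u x s)).
  - now apply is_derive_t_pdx1.
  - now apply is_derive_t_pdx2.
  - now apply is_derive_t_pdx3.
  - now apply is_derive_t_pdx4.
Qed.

Lemma is_derive_x_cos_u (u : R -> R -> R) (x t : R) :
  sufficiently_smooth u -> 0 < t ->
  is_derive (fun y => cos (u y t)) x (- sin (u x t) * pdx 1 u x t).
Proof.
  intros Hu Ht; apply (is_derive_cos_comp (fun y => u y t)); smooth_jets.
Qed.

(** With [e] in the role of E_tau, the hypotheses express E_tau = G_y, a law of the sine-Gordon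
    equation itself. *)
Lemma sine_Gordon_local_law (u E G e Ex : R -> R -> R) :
  sufficiently_smooth u -> generalized_sine_Gordon u ->
  (forall x t, 0 < t -> is_derive (fun y => E y t) x (Ex x t)) ->
  (forall x t, 0 < t ->
     is_derive (fun s => E x s) t (e x t - cos (u x t) * Ex x t)) ->
  (forall x t, 0 < t ->
     is_derive (fun y => G y t) x (metric u x t * e x t)) ->
  local_law (fun x t => metric u x t * E x t)
    (fun x t => G x t - cos (u x t) * (metric u x t * E x t))
    (fun x t => metric u x t * e x t
       - (- sin (u x t) * pdx 1 u x t * (metric u x t * E x t)
          + cos (u x t) * (metric_x u x t * E x t + metric u x t * Ex x t))).
Proof.
  intros Hu Heq HEx HEt HG.
  apply (reciprocal_local_law (metric u) (fun x t => cos (u x t)) E G e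
    (metric_x u) (fun x t => - sin (u x t) * pdx 1 u x t) Ex);
    [..|assumption|assumption|assumption]; intros x t Ht.
  - now apply is_derive_x_metric.
  - now apply is_derive_t_metric.
  - now apply is_derive_x_cos_u.
Qed.

Lemma continuity_2d_pt_metric (u : R -> R -> R) (x t : R) :
  sufficiently_smooth u -> 0 < t -> continuity_2d_pt (metric u) x t.
Proof.
  intros Hu Ht; unfold metric, sg_h; continuous_2d; smooth_jets.
Qed.

Lemma continuity_2d_pt_metric_x (u : R -> R -> R) (x t : R) :
  sufficiently_smooth u -> 0 < t -> continuity_2d_pt (metric_x u) x t.
Proof.
  intros Hu Ht; unfold metric_x; continuous_2d; smooth_jets.
Qed.

Ltac continuous_jets :=
  continuous_2d;
  first [ smooth_jets
        | cbv beta; try apply pow_nonzero;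
          apply Rgt_not_eq, one_plus_square_pos ].

Lemma continuity_2d_pt_w_y (u : R -> R -> R) (x t : R) :
  sufficiently_smooth u -> 0 < t -> continuity_2d_pt (w_y u) x t.
Proof. intros Hu Ht; unfold w_y, sg_v; continuous_jets. Qed.

Lemma continuity_2d_pt_w_yy (u : R -> R -> R) (x t : R) :
  sufficiently_smooth u -> 0 < t -> continuity_2d_pt (w_yy u) x t.
Proof. intros Hu Ht; unfold w_yy, sg_v1; continuous_jets. Qed.

Lemma continuity_2d_pt_w_yyy (u : R -> R -> R) (x t : R) :
  sufficiently_smooth u -> 0 < t -> continuity_2d_pt (w_yyy u) x t.
Proof. intros Hu Ht; unfold w_yyy, sg_v2; continuous_jets. Qed.

Lemma continuity_2d_pt_w_yyyy (u : R -> R -> R) (x t : R) :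
  sufficiently_smooth u -> 0 < t -> continuity_2d_pt (w_yyyy u) x t.
Proof. intros Hu Ht; unfold w_yyyy, sg_v3; continuous_jets. Qed.

Lemma continuity_2d_pt_sin_w (u : R -> R -> R) (x t : R) :
  sufficiently_smooth u -> 0 < t -> continuity_2d_pt (sin_w u) x t.
Proof. intros Hu Ht; unfold sin_w, sg_sin; continuous_jets. Qed.

Lemma continuity_2d_pt_cos_w (u : R -> R -> R) (x t : R) :
  sufficiently_smooth u -> 0 < t -> continuity_2d_pt (cos_w u) x t.
Proof. intros Hu Ht; unfold cos_w, sg_cos; continuous_jets. Qed.

Lemma sine_Gordon_continuous_law (u E G e Ex : R -> R -> R) :
  sufficiently_smooth u -> generalized_sine_Gordon u ->
  (forall x t, 0 < t -> is_derive (fun y => E y t) x (Ex x t)) ->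
  (forall x t, 0 < t ->
     is_derive (fun s => E x s) t (e x t - cos (u x t) * Ex x t)) ->
  (forall x t, 0 < t ->
     is_derive (fun y => G y t) x (metric u x t * e x t)) ->
  continuous_xt E -> continuous_xt e -> continuous_xt Ex ->
  exists d,
    local_law (fun x t => metric u x t * E x t)
      (fun x t => G x t - cos (u x t) * (metric u x t * E x t)) d
    /\ continuous_xt d.
Proof.
  intros Hu Heq HEx HEt HG CE Ce CEx; eexists; split.
  - now apply (sine_Gordon_local_law u E G e Ex).
  - intros x t Ht.
    specialize (CE x t Ht); specialize (Ce x t Ht); specialize (CEx x t Ht).
    pose proof (continuity_2d_pt_metric u x t Hu Ht).
    pose proof (continuity_2d_pt_metric_x u x t Hu Ht).
    continuous_2d; smooth_jets.
Qed.

Ltac continuous_w Hu Ht :=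
  lazymatch type of Hu with sufficiently_smooth ?u =>
  lazymatch type of Ht with 0 < ?t =>
  lazymatch goal with |- continuity_2d_pt _ ?x _ =>
    pose proof (continuity_2d_pt_metric u x t Hu Ht);
    pose proof (continuity_2d_pt_w_y u x t Hu Ht);
    pose proof (continuity_2d_pt_w_yy u x t Hu Ht);
    pose proof (continuity_2d_pt_w_yyy u x t Hu Ht);
    pose proof (continuity_2d_pt_w_yyyy u x t Hu Ht);
    pose proof (continuity_2d_pt_sin_w u x t Hu Ht);
    pose proof (continuity_2d_pt_cos_w u x t Hu Ht)
  end end end;
  continuous_2d; lra.

(* The classical densities of w_ytau = sin w, with v, v1, v2 in place of
   w_y, w_yy, w_yyy. *)
Definition density1 (v : R) : R := v ^ 2 / 2.

Definition density2 (v v1 : R) : R := (v ^ 4 - 4 * v1 ^ 2) / 8.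

Definition density3 (v v1 v2 : R) : R :=
  (v ^ 6 - 20 * v ^ 2 * v1 ^ 2 + 8 * v2 ^ 2) / 16.

(** Here c stands for cos w. By v_tau = sin w and v1_tau = v * cos w, the tau-derivative of
    [density2] is (v ^ 3 * sin w - 2 * v * v1 * cos w) / 2; this is an exact y-derivative because
    (cos w)_y = -v * sin w. *)
Definition flux2 (v c : R) : R := - (v ^ 2 * c) / 2.

(** Here s and c stand for sin w and cos w. In 16 times the tau-derivative of [density3], the terms
    16 * v2 * (v1 * c - v ^ 2 * s) force 8 * v1 ^ 2 * c - 16 * v ^ 2 * v1 * s, and 6 * v ^ 5 * s
    forces -6 * v ^ 4 * c. The coefficients of the density make the remaining terms match. *)
Definition flux3 (v v1 s c : R) : R :=
  ((8 * v1 ^ 2 - 6 * v ^ 4) * c - 16 * v ^ 2 * v1 * s) / 16.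

Lemma is_derive_density1 (v : R -> R) (s dv : R) :
  is_derive v s dv ->
  is_derive (fun y => density1 (v y)) s (v s * dv).
Proof. intros Hv; unfold density1; derive_along; field. Qed.

Lemma is_derive_density2 (v v1 : R -> R) (s dv dv1 : R) :
  is_derive v s dv -> is_derive v1 s dv1 ->
  is_derive (fun y => density2 (v y) (v1 y)) s
    ((v s ^ 3 * dv - 2 * v1 s * dv1) / 2).
Proof. intros Hv Hv1; unfold density2; derive_along; field. Qed.

Lemma is_derive_density3 (v v1 v2 : R -> R) (s dv dv1 dv2 : R) :
  is_derive v s dv -> is_derive v1 s dv1 -> is_derive v2 s dv2 ->
  is_derive (fun y => density3 (v y) (v1 y) (v2 y)) s
    ((3 * v s ^ 5 * dv - 20 * v s * v1 s ^ 2 * dv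
      - 20 * v s ^ 2 * v1 s * dv1 + 8 * v2 s * dv2) / 8).
Proof. intros Hv Hv1 Hv2; unfold density3; derive_along; field. Qed.

Lemma is_derive_flux2 (v c : R -> R) (s dv dc : R) :
  is_derive v s dv -> is_derive c s dc ->
  is_derive (fun y => flux2 (v y) (c y)) s
    (- (2 * v s * dv * c s + v s ^ 2 * dc) / 2).
Proof. intros Hv Hc; unfold flux2; derive_along; field. Qed.

Lemma is_derive_flux3 (v v1 si c : R -> R) (s dv dv1 ds dc : R) :
  is_derive v s dv -> is_derive v1 s dv1 ->
  is_derive si s ds -> is_derive c s dc ->
  is_derive (fun y => flux3 (v y) (v1 y) (si y) (c y)) s
    (((16 * v1 s * dv1 - 24 * v s ^ 3 * dv) * c s
      + (8 * v1 s ^ 2 - 6 * v s ^ 4) * dc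
      - 16 * (2 * v s * dv * v1 s * si s + v s ^ 2 * dv1 * si s
              + v s ^ 2 * v1 s * ds)) / 16).
Proof. intros Hv Hv1 Hsi Hc; unfold flux3; derive_along; field. Qed.

(** (w_y ^ 2 / 2)_tau = w_y * sin w = (-cos w)_y. *)
Lemma local_law1 (u : R -> R -> R) :
  sufficiently_smooth u -> generalized_sine_Gordon u ->
  exists d,
    local_law (fun x t => metric u x t * density1 (w_y u x t))
      (fun x t => - cos_w u x t
         - cos (u x t) * (metric u x t * density1 (w_y u x t))) d.
Proof.
  intros Hu Heq; eexists.
  apply (sine_Gordon_local_law u (fun x t => density1 (w_y u x t))
    (fun x t => - cos_w u x t)
    (fun x t => w_y u x t * sin_w u x t)
    (fun x t => w_y u x t * (metric u x t * w_yy u x t)) Hu Heq);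
    intros x t Ht.
  - apply (is_derive_density1 (fun y => w_y u y t)).
    now apply is_derive_x_w_y.
  - evar_last.
    + apply (is_derive_density1 (fun s => w_y u x s)).
      now apply is_derive_t_w_y.
    + simpl; ring.
  - evar_last.
    + apply (is_derive_opp (fun y => cos_w u y t)).
      now apply is_derive_x_cos_w.
    + unfold opp; simpl; ring.
Qed.

Lemma local_law2 (u : R -> R -> R) :
  sufficiently_smooth u -> generalized_sine_Gordon u ->
  exists d,
    local_law (fun x t => metric u x t * density2 (w_y u x t) (w_yy u x t))
      (fun x t => flux2 (w_y u x t) (cos_w u x t)
         - cos (u x t) * (metric u x t * density2 (w_y u x t) (w_yy u x t))) d
    /\ continuous_xt d.
Proof.
  intros Hu Heq.
  apply (sine_Gordon_continuous_law u
    (fun x t => density2 (w_y u x t) (w_yy u x t))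
    (fun x t => flux2 (w_y u x t) (cos_w u x t))
    (fun x t => (w_y u x t ^ 3 * sin_w u x t
                 - 2 * w_yy u x t * (w_y u x t * cos_w u x t)) / 2)
    (fun x t => (w_y u x t ^ 3 * (metric u x t * w_yy u x t)
                 - 2 * w_yy u x t * (metric u x t * w_yyy u x t)) / 2) Hu Heq);
    intros x t Ht.
  - apply (is_derive_density2 (fun y => w_y u y t) (fun y => w_yy u y t)).
    + now apply is_derive_x_w_y.
    + now apply is_derive_x_w_yy.
  - evar_last.
    + apply (is_derive_density2 (fun s => w_y u x s) (fun s => w_yy u x s)).
      * now apply is_derive_t_w_y.
      * now apply is_derive_t_w_yy.
    + simpl; field.
  - evar_last.
    + apply (is_derive_flux2 (fun y => w_y u y t) (fun y => cos_w u y t)).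
      * now apply is_derive_x_w_y.
      * now apply is_derive_x_cos_w.
    + simpl; field.
  - unfold density2; continuous_w Hu Ht.
  - continuous_w Hu Ht.
  - continuous_w Hu Ht.
Qed.

Lemma local_law3 (u : R -> R -> R) :
  sufficiently_smooth u -> generalized_sine_Gordon u ->
  exists d,
    local_law
      (fun x t =>
         metric u x t * density3 (w_y u x t) (w_yy u x t) (w_yyy u x t))
      (fun x t => flux3 (w_y u x t) (w_yy u x t) (sin_w u x t) (cos_w u x t)
         - cos (u x t) *
           (metric u x t * density3 (w_y u x t) (w_yy u x t) (w_yyy u x t))) d
    /\ continuous_xt d.
Proof.
  intros Hu Heq.
  apply (sine_Gordon_continuous_law u
    (fun x t => density3 (w_y u x t) (w_yy u x t) (w_yyy u x t))
    (fun x t => flux3 (w_y u x t) (w_yy u x t) (sin_w u x t) (cos_w u x t))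
    (fun x t => (3 * w_y u x t ^ 5 * sin_w u x t
           - 20 * w_y u x t * w_yy u x t ^ 2 * sin_w u x t
           - 20 * w_y u x t ^ 2 * w_yy u x t * (w_y u x t * cos_w u x t)
           + 8 * w_yyy u x t *
               (w_yy u x t * cos_w u x t
                - w_y u x t * w_y u x t * sin_w u x t)) / 8)
    (fun x t => (3 * w_y u x t ^ 5 * (metric u x t * w_yy u x t)
           - 20 * w_y u x t * w_yy u x t ^ 2 * (metric u x t * w_yy u x t)
           - 20 * w_y u x t ^ 2 * w_yy u x t * (metric u x t * w_yyy u x t)
           + 8 * w_yyy u x t * (metric u x t * w_yyyy u x t)) / 8) Hu Heq);
    intros x t Ht.
  - apply (is_derive_density3 (fun y => w_y u y t) (fun y => w_yy u y t)
      (fun y => w_yyy u y t)).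
    + now apply is_derive_x_w_y.
    + now apply is_derive_x_w_yy.
    + now apply is_derive_x_w_yyy.
  - evar_last.
    + apply (is_derive_density3 (fun s => w_y u x s) (fun s => w_yy u x s)
        (fun s => w_yyy u x s)).
      * now apply is_derive_t_w_y.
      * now apply is_derive_t_w_yy.
      * now apply is_derive_t_w_yyy.
    + simpl; field.
  - evar_last.
    + apply (is_derive_flux3 (fun y => w_y u y t) (fun y => w_yy u y t)
        (fun y => sin_w u y t) (fun y => cos_w u y t)).
      * now apply is_derive_x_w_y.
      * now apply is_derive_x_w_yy.
      * now apply is_derive_x_sin_w.
      * now apply is_derive_x_cos_w.
    + simpl; field.
  - unfold density3; continuous_w Hu Ht.
  - continuous_w Hu Ht.
  - continuous_w Hu Ht.
Qed.

(** * Behaviour at infinity *)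

(** Recorded through sin u and cos u because u may tend to different multiples of 2 * PI at the two
    ends, while these limits are the same at both. *)
Definition far_field (u : R -> R -> R) (t : R) (X : Rbar) : Prop :=
  is_lim (fun x => sin (u x t)) X 0 /\ is_lim (fun x => cos (u x t)) X 1
  /\ forall n, (1 <= n <= 4)%nat -> is_lim (fun x => pdx n u x t) X 0.

Lemma sin_2PI_IZR (k : Z) : sin (2 * PI * IZR k) = 0.
Proof.
  apply sin_eq_0_1; exists (2 * k)%Z.
  rewrite mult_IZR; ring.
Qed.

Lemma cos_2PI_IZR (k : Z) : cos (2 * PI * IZR k) = 1.
Proof.
  replace (2 * PI * IZR k) with (2 * (IZR k * PI)) by ring.
  rewrite cos_2a_sin, (sin_eq_0_1 (IZR k * PI)); [ring | now exists k].
Qed.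

Lemma is_lim_2PI_far_field (u : R -> R -> R) (t : R) (X : Rbar) (k : Z) :
  is_lim (fun x => u x t) X (2 * PI * IZR k) ->
  (forall n, (1 <= n <= 4)%nat -> is_lim (fun x => pdx n u x t) X 0) ->
  far_field u t X.
Proof.
  intros Hk Hn; split; [|split; [|exact Hn]].
  - rewrite <- (sin_2PI_IZR k).
    apply is_lim_comp_continuous; [exact Hk|].
    apply continuity_pt_filterlim, continuity_sin.
  - rewrite <- (cos_2PI_IZR k).
    apply is_lim_comp_continuous; [exact Hk|].
    apply continuity_pt_filterlim, continuity_cos.
Qed.

Lemma sufficient_decay_far_field (u : R -> R -> R) (t : R) :
  sufficient_decay u -> 0 < t ->
  far_field u t m_infty /\ far_field u t p_infty.
Proof.
  intros [[k1 [k2 Hk]] [Hn _]] Ht; destruct (Hk t Ht) as [H1 H2]; split.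
  - apply is_lim_2PI_far_field with k1; [exact H1|].
    intros n Hn'; now apply Hn.
  - apply is_lim_2PI_far_field with k2; [exact H2|].
    intros n Hn'; now apply Hn.
Qed.

(** Lets [limits] assemble the limit as an unevaluated expression, which is computed afterwards. *)
Lemma is_lim_value (f : R -> R) (X : Rbar) (l l' : R) :
  is_lim f X l -> l = l' -> is_lim f X l'.
Proof. now intros H <-. Qed.

Lemma is_lim_inv_metric (p : R -> R) (X : Rbar) :
  is_lim p X 0 -> is_lim (fun x => inv_metric (p x)) X 1.
Proof.
  intros H; apply is_lim_value with (inv_metric 0).
  - apply is_lim_comp_continuous; [exact H|].
    apply (ex_derive_continuous inv_metric); eexists; apply is_derive_inv_metric.
  - unfold inv_metric; replace (1 + 0 ^ 2) with 1 by ring.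
    rewrite sqrt_1; field.
Qed.

Ltac limits :=
  repeat first
    [ eassumption | apply is_lim_const
    | eapply is_lim_inv_metric
    | eapply is_lim_plus' | eapply is_lim_minus'
    | eapply is_lim_opp_finite | eapply is_lim_mult_finite
    | eapply is_lim_pow_finite | eapply is_lim_inv_finite ].

Lemma is_lim_metric (u : R -> R -> R) (t : R) (X : Rbar) :
  far_field u t X -> is_lim (fun x => metric u x t) X 1.
Proof.
  intros [_ [_ Hn]].
  pose proof (Hn 1%nat ltac:(lia)) as Hp.
  unfold metric, sg_h; eapply is_lim_value; [limits | ring].
Qed.

Lemma is_lim_w_y (u : R -> R -> R) (t : R) (X : Rbar) :
  far_field u t X -> is_lim (fun x => w_y u x t) X 0.
Proof.
  intros [_ [_ Hn]].
  pose proof (Hn 1%nat ltac:(lia)) as Hp; pose proof (Hn 2%nat ltac:(lia)) as Hq.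
  unfold w_y, sg_v; eapply is_lim_value; [limits; lra | field; lra].
Qed.

Lemma is_lim_w_yy (u : R -> R -> R) (t : R) (X : Rbar) :
  far_field u t X -> is_lim (fun x => w_yy u x t) X 0.
Proof.
  intros [_ [_ Hn]].
  pose proof (Hn 1%nat ltac:(lia)) as Hp; pose proof (Hn 2%nat ltac:(lia)) as Hq.
  pose proof (Hn 3%nat ltac:(lia)) as Hr.
  unfold w_yy, sg_v1; eapply is_lim_value; [limits; lra | field; lra].
Qed.

Lemma is_lim_w_yyy (u : R -> R -> R) (t : R) (X : Rbar) :
  far_field u t X -> is_lim (fun x => w_yyy u x t) X 0.
Proof.
  intros [_ [_ Hn]].
  pose proof (Hn 1%nat ltac:(lia)) as Hp; pose proof (Hn 2%nat ltac:(lia)) as Hq.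
  pose proof (Hn 3%nat ltac:(lia)) as Hr; pose proof (Hn 4%nat ltac:(lia)) as Ha.
  unfold w_yyy, sg_v2; eapply is_lim_value; [limits; lra | field; lra].
Qed.

Lemma is_lim_sin_w (u : R -> R -> R) (t : R) (X : Rbar) :
  far_field u t X -> is_lim (fun x => sin_w u x t) X 0.
Proof.
  intros [HS [HC Hn]].
  pose proof (Hn 1%nat ltac:(lia)) as Hp.
  unfold sin_w, sg_sin; eapply is_lim_value; [limits | ring].
Qed.

Lemma is_lim_cos_w (u : R -> R -> R) (t : R) (X : Rbar) :
  far_field u t X -> is_lim (fun x => cos_w u x t) X 1.
Proof.
  intros [HS [HC Hn]].
  pose proof (Hn 1%nat ltac:(lia)) as Hp.
  unfold cos_w, sg_cos; eapply is_lim_value; [limits | ring].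
Qed.

(** The factors cos u, cos w and sqrt m tend to 1, but every term carries a positive power of w_y or
    w_yy. *)
Lemma is_lim_total_flux2 (u : R -> R -> R) (t : R) (X : Rbar) :
  far_field u t X ->
  is_lim (fun x => flux2 (w_y u x t) (cos_w u x t)
     - cos (u x t) * (metric u x t * density2 (w_y u x t) (w_yy u x t))) X 0.
Proof.
  intros H; pose proof (proj1 (proj2 H)) as HC.
  pose proof (is_lim_metric u t X H); pose proof (is_lim_w_y u t X H).
  pose proof (is_lim_w_yy u t X H); pose proof (is_lim_cos_w u t X H).
  unfold flux2, density2; eapply is_lim_value; [limits; lra | field].
Qed.

Lemma is_lim_total_flux3 (u : R -> R -> R) (t : R) (X : Rbar) :
  far_field u t X ->
  is_lim (fun x =>
     flux3 (w_y u x t) (w_yy u x t) (sin_w u x t) (cos_w u x t)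
     - cos (u x t) *
       (metric u x t * density3 (w_y u x t) (w_yy u x t) (w_yyy u x t))) X 0.
Proof.
  intros H; pose proof (proj1 (proj2 H)) as HC.
  pose proof (is_lim_metric u t X H); pose proof (is_lim_w_y u t X H).
  pose proof (is_lim_w_yy u t X H); pose proof (is_lim_w_yyy u t X H).
  pose proof (is_lim_sin_w u t X H); pose proof (is_lim_cos_w u t X H).
  unfold flux3, density3; eapply is_lim_value; [limits; lra | field].
Qed.

(** * The time derivative of w *)

(* This is w_t + cos u * w_x, with u_xt eliminated through the equation. *)
Definition w_tau (u : R -> R -> R) (x t : R) : R :=
  pdt u x t + sin (u x t) + cos (u x t) * pdx 1 u x t.

(** The equation cancels (sin u)_xx against its counterpart in u_xt. What remains is sqrt m * sin w,
    that is, w_tauy = sin w; thus w_tau is an antiderivative of the nonlocal integrand. *)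
Lemma is_derive_x_w_tau (u : R -> R -> R) (x t : R) :
  sufficiently_smooth u -> generalized_sine_Gordon u -> 0 < t ->
  is_derive (fun y => w_tau u y t) x
    (sin (u x t) + cos (u x t) * pdx 1 u x t).
Proof.
  intros Hu Heq Ht; evar_last.
  - apply (is_derive_plus (fun y => pdt u y t + sin (u y t))
      (fun y => cos (u y t) * pdx 1 u y t)).
    + apply (is_derive_plus (fun y => pdt u y t) (fun y => sin (u y t))).
      * now apply is_derive_x_pdt_u.
      * apply (is_derive_sin_comp (fun y => u y t)); smooth_jets.
    + apply (is_derive_cos_mult (fun y => u y t) (fun y => pdx 1 u y t));
        smooth_jets.
  - unfold plus, rhs_xt; simpl; ring.
Qed.

Lemma pdt_sinu_plus (u : R -> R -> R) (x t : R) :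
  sufficiently_smooth u -> generalized_sine_Gordon u -> 0 < t ->
  pdt (fun x t => sinu u x t + pdx 1 (sinu u) x t) x t
  = cos (u x t) * pdt u x t
    + (- sin (u x t) * pdt u x t * pdx 1 u x t
       + cos (u x t) * rhs_xt (u x t) (pdx 1 u x t) (pdx 2 u x t)).
Proof.
  intros Hu Heq Ht; apply is_derive_unique.
  apply is_derive_ext_loc
    with (fun s => sin (u x s) + cos (u x s) * pdx 1 u x s).
  - apply (filter_imp (fun s => 0 < s)); [|now apply locally_positive].
    intros s Hs; unfold sinu at 1; now rewrite pdx_sinu.
  - apply (is_derive_plus (fun s => sin (u x s))
      (fun s => cos (u x s) * pdx 1 u x s)).
    + apply (is_derive_sin_comp (fun s => u x s)); now apply is_derive_t_u.
    + apply (is_derive_cos_mult (fun s => u x s) (fun s => pdx 1 u x s)).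
      * now apply is_derive_t_u.
      * now apply is_derive_t_pdx1.
Qed.

(* The equation only gives that u_t has some limit L at -oo; the t-derivative
   of sin u + (sin u)_x then tends to L too, and its integrability forces
   L = 0. *)
Lemma pdx_inv_sinu (u : R -> R -> R) (x t : R) :
  sufficiently_smooth u -> sufficient_decay u -> generalized_sine_Gordon u ->
  0 < t ->
  pdx_inv (fun y s => sinu u y s + pdx 1 (sinu u) y s) x t = w_tau u x t.
Proof.
  intros Hu Hdecay Heq Ht.
  destruct (sufficient_decay_far_field u t Hdecay Ht) as [[HS [HC Hn]] _].
  destruct Hdecay as [_ [_ [Hint [Hdiff _]]]].
  pose proof (Hn 1%nat ltac:(lia)) as Hp; pose proof (Hn 2%nat ltac:(lia)) as Hq.
  set (I := pdx_inv _ x t).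
  assert (HI : is_RInt_gen
    (fun y => sin (u y t) + cos (u y t) * pdx 1 u y t)
    (Rbar_locally m_infty) (at_point x) I).
  { apply (is_RInt_gen_ext (fun y => sinu u y t + pdx 1 (sinu u) y t)).
    - apply filter_forall; intros ab y _.
      unfold sinu at 1; now rewrite pdx_sinu.
    - apply (RInt_gen_correct (fun y => sinu u y t + pdx 1 (sinu u) y t)).
      exact (proj1 (proj2 (Hint t Ht)) x). }
  assert (HK : is_lim (fun y => w_tau u y t) m_infty (w_tau u x t - I)).
  { apply (is_lim_antiderivative_m_infty (fun y => w_tau u y t)
      (fun y => sin (u y t) + cos (u y t) * pdx 1 u y t)).
    - intros y; now apply is_derive_x_w_tau.
    - intros y.
      apply (continuity_2d_pt_section
        (fun y s => sin (u y s) + cos (u y s) * pdx 1 u y s)).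
      continuous_2d; smooth_jets.
    - exact HI. }
  assert (HL : is_lim (fun y => pdt u y t) m_infty (w_tau u x t - I)).
  { apply is_lim_ext
      with (fun y => w_tau u y t - sin (u y t) - cos (u y t) * pdx 1 u y t).
    - intros y; unfold w_tau; ring.
    - eapply is_lim_value; [limits | ring]. }
  (* The limit of u_t at minus infinity is exactly the discrepancy between the two sides of the
     claim. *)
  enough (w_tau u x t - I = 0) by lra.
  apply (ex_RInt_gen_limit_zero
    (fun y => pdt (fun x t => sinu u x t + pdx 1 (sinu u) x t) y t) x).
  - exact (proj1 (Hdiff x t Ht)).
  - apply is_lim_ext with (fun y => cos (u y t) * pdt u y t
      + (- sin (u y t) * pdt u y t * pdx 1 u y t
         + cos (u y t) * rhs_xt (u y t) (pdx 1 u y t) (pdx 2 u y t))).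
    + intros y; symmetry; now apply pdt_sinu_plus.
    + unfold rhs_xt; eapply is_lim_value; [limits | ring].
Qed.

(** (cos w)_t = (cos w)_tau - cos u * (cos w)_x, where (cos w)_tau = -w_tau * sin w. *)
Lemma is_derive_t_cos_w (u : R -> R -> R) (x t : R) :
  sufficiently_smooth u -> generalized_sine_Gordon u -> 0 < t ->
  is_derive (fun s => cos_w u x s) t
    (- (w_tau u x t * sin_w u x t)
     - cos (u x t) * - (metric u x t * w_y u x t * sin_w u x t)).
Proof.
  intros Hu Heq Ht; evar_last.
  - apply (is_derive_sg_cos (fun s => u x s) (fun s => pdx 1 u x s)).
    + now apply is_derive_t_u.
    + now apply is_derive_t_pdx1.
  - rewrite metric_mult_w_y; unfold sin_w, w_tau, rhs_xt.
    pose proof (one_plus_square_pos (pdx 1 u x t)); field; lra.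
Qed.

(** (cos w)_tau = -w_tau * sin w = -w_tau * w_tauy = (-w_tau ^ 2 / 2)_y. The constant -1 subtracts
    the law of sqrt m, whence the term -sqrt m in the density. *)
Lemma local_law0 (u : R -> R -> R) :
  sufficiently_smooth u -> generalized_sine_Gordon u ->
  exists d,
    local_law (fun x t => metric u x t * (cos_w u x t - 1))
      (fun x t => - (1 / 2) * w_tau u x t ^ 2
         - cos (u x t) * (metric u x t * (cos_w u x t - 1))) d.
Proof.
  intros Hu Heq; eexists.
  apply (sine_Gordon_local_law u (fun x t => cos_w u x t - 1)
    (fun x t => - (1 / 2) * w_tau u x t ^ 2)
    (fun x t => - (w_tau u x t * sin_w u x t))
    (fun x t => - (metric u x t * w_y u x t * sin_w u x t)) Hu Heq);
    intros x t Ht.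
  - evar_last.
    + apply (is_derive_minus (fun y => cos_w u y t)).
      * now apply is_derive_x_cos_w.
      * apply @is_derive_const.
    + unfold minus, plus, opp, zero; simpl; ring.
  - evar_last.
    + apply (is_derive_minus (fun s => cos_w u x s)).
      * now apply is_derive_t_cos_w.
      * apply @is_derive_const.
    + unfold minus, plus, opp, zero; simpl; ring.
  - evar_last.
    + apply is_derive_scal, is_derive_pow.
      now apply is_derive_x_w_tau.
    + replace (metric u x t * - (w_tau u x t * sin_w u x t))
        with (- (w_tau u x t * (metric u x t * sin_w u x t))) by ring.
      rewrite metric_mult_sin_w; simpl; field.
Qed.

(** * Comparison with the densities in u *)

Lemma inv_Rpower_half (m : R) (n : nat) :
  0 < m -> / Rpower m (INR n + / 2) = / (m ^ n * sqrt m).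
Proof.
  intros Hm; now rewrite Rpower_plus, Rpower_pow, Rpower_sqrt.
Qed.

(** Translates the half-integer powers of m in the statement into [inv_metric] times a rational
    function. *)
Lemma inv_Rpower_metric (p : R) (n : nat) :
  / Rpower (1 + p ^ 2) (INR n + / 2) = inv_metric p / (1 + p ^ 2) ^ n.
Proof.
  rewrite inv_Rpower_half by apply one_plus_square_pos.
  rewrite Rinv_mult; apply Rmult_comm.
Qed.

Lemma sg_v_square (p q : R) :
  sg_v p q ^ 2 = (p + q / (1 + p ^ 2)) ^ 2 / (1 + p ^ 2).
Proof.
  unfold sg_v; now rewrite Rpow_mult_distr, inv_metric_square.
Qed.

(** With m_x = 2 * u_x * u_xx, the two blocks are u_xx / m + u_x = sqrt m * w_y and 3 * m_x * u_xx -
    2 * m * (u_xx + u_xxx) = -2 * m ^ 3 * w_yy. *)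
Lemma H2_density_metric (u : R -> R -> R) (x t : R) :
  sufficiently_smooth u -> 0 < t ->
  H2_density u x t = metric u x t * density2 (w_y u x t) (w_yy u x t).
Proof.
  intros Hu Ht; unfold H2_density; rewrite pdx_m_of by assumption.
  unfold m_of, metric, w_y, w_yy, density2.
  generalize (pdx 1 u x t) (pdx 2 u x t) (pdx 3 u x t); intros p q r.
  pose proof (one_plus_square_pos p) as Hm.
  replace (sg_v p q ^ 4) with ((sg_v p q ^ 2) ^ 2) by ring.
  rewrite sg_v_square.
  replace (3 / 2) with (INR 1 + / 2) by (simpl; field).
  unfold Rdiv at 1; rewrite Rinv_mult, inv_Rpower_metric.
  unfold sg_h, sg_v1; field; lra.
Qed.

(** Besides the blocks of [H2_density], m * u_x + u_xx is m ^ (3/2) * w_y and the last squared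
    bracket is m ^ (9/2) * w_yyy. Every term then carries m ^ 3, and m ^ 3 / m ^ (5/2) = sqrt m. *)
Lemma H3_density_metric (u : R -> R -> R) (x t : R) :
  sufficiently_smooth u -> 0 < t ->
  H3_density u x t
  = metric u x t * density3 (w_y u x t) (w_yy u x t) (w_yyy u x t).
Proof.
  intros Hu Ht; unfold H3_density; rewrite pdx_m_of by assumption.
  unfold m_of, metric, w_y, w_yy, w_yyy, density3.
  generalize (pdx 1 u x t) (pdx 2 u x t) (pdx 3 u x t) (pdx 4 u x t).
  intros p q r a.
  pose proof (one_plus_square_pos p) as Hm.
  replace (sg_v p q ^ 6) with ((sg_v p q ^ 2) ^ 3) by ring.
  rewrite sg_v_square.
  unfold sg_v2; rewrite (Rpow_mult_distr _ (inv_metric p)), inv_metric_square.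
  replace (5 / 2) with (INR 2 + / 2) by (simpl; field).
  unfold Rdiv at 1; rewrite Rinv_mult, inv_Rpower_metric.
  unfold sg_h, sg_v1; field; lra.
Qed.

Lemma density1_metric (u : R -> R -> R) (x t : R) :
  (m_of u x t * pdx 1 u x t + pdx 2 u x t) ^ 2
  / (2 * Rpower (m_of u x t) (5 / 2))
  = metric u x t * density1 (w_y u x t).
Proof.
  unfold m_of, metric, w_y, density1; rewrite sg_v_square.
  generalize (pdx 1 u x t) (pdx 2 u x t); intros p q.
  pose proof (one_plus_square_pos p) as Hm.
  replace (5 / 2) with (INR 2 + / 2) by (simpl; field).
  unfold Rdiv at 1; rewrite Rinv_mult, inv_Rpower_metric.
  unfold sg_h; field; lra.
Qed.

(** By u_x ^ 2 = m - 1 and m_x = 2 * u_x * u_xx, m * (m ^ 2 + m + m_x) + u_xx ^ 2 = 2 * m ^ 2 + (m *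
    u_x + u_xx) ^ 2. The first summand, with the sin u term, gives -cos w; the second gives the
    transported density. *)
Lemma flux1_metric (u : R -> R -> R) (x t : R) :
  sufficiently_smooth u -> 0 < t ->
  ((- m_of u x t * ((m_of u x t) ^ 2 + m_of u x t + pdx 1 (m_of u) x t)
    - (pdx 2 u x t) ^ 2) * cosu u x t
   + 2 * (m_of u x t) ^ 2 * pdx 1 u x t * sinu u x t)
  / (2 * Rpower (m_of u x t) (5 / 2))
  = - cos_w u x t - cos (u x t) * (metric u x t * density1 (w_y u x t)).
Proof.
  intros Hu Ht; rewrite pdx_m_of by assumption.
  unfold m_of, cosu, sinu, metric, cos_w, w_y, density1; rewrite sg_v_square.
  generalize (u x t) (pdx 1 u x t) (pdx 2 u x t); intros z p q.
  pose proof (one_plus_square_pos p) as Hm.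
  replace (5 / 2) with (INR 2 + / 2) by (simpl; field).
  unfold Rdiv at 1; rewrite Rinv_mult, inv_Rpower_metric.
  unfold sg_h, sg_cos; field; lra.
Qed.

Lemma density0_metric (u : R -> R -> R) (x t : R) :
  sufficiently_smooth u -> 0 < t ->
  cosu u x t + pdx 1 (cosu u) x t - sqrt (m_of u x t)
  = metric u x t * (cos_w u x t - 1).
Proof.
  intros Hu Ht; rewrite pdx_cosu by assumption.
  unfold m_of; rewrite sqrt_inv_metric; fold (sg_h (pdx 1 u x t)).
  rewrite Rmult_minus_distr_l, metric_mult_cos_w.
  unfold cosu, metric; ring.
Qed.

Theorem mainTheorem5 (u : R -> R -> R)
  (Hsmooth : sufficiently_smooth u)
  (Hdecay : sufficient_decay u)
  (Heq : generalized_sine_Gordon u) :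
  conservation_law
    (fun x t => cosu u x t + pdx 1 (cosu u) x t - sqrt (m_of u x t))
    (fun x t =>
       - (1 / 2) * (pdx_inv (fun y s => sinu u y s + pdx 1 (sinu u) y s) x t) ^ 2
       - (cosu u x t + pdx 1 (cosu u) x t - sqrt (m_of u x t)) * cosu u x t)
  /\ conservation_law
    (fun x t =>
       (m_of u x t * pdx 1 u x t + pdx 2 u x t) ^ 2
       / (2 * Rpower (m_of u x t) (5 / 2)))
    (fun x t =>
       ((- m_of u x t * ((m_of u x t) ^ 2 + m_of u x t + pdx 1 (m_of u) x t)
         - (pdx 2 u x t) ^ 2) * cosu u x t
        + 2 * (m_of u x t) ^ 2 * pdx 1 u x t * sinu u x t)
       / (2 * Rpower (m_of u x t) (5 / 2)))
  /\ conserved (H2 u)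
  /\ conserved (H3 u).
Proof.
  destruct (local_law0 u Hsmooth Heq) as [d0 L0].
  destruct (local_law1 u Hsmooth Heq) as [d1 L1].
  destruct (local_law2 u Hsmooth Heq) as [d2 [L2 C2]].
  destruct (local_law3 u Hsmooth Heq) as [d3 [L3 C3]].
  split; [|split; [|split]].
  - eapply local_law_conservation_law.
    + apply (local_law_density_ext _ _ _ _ L0).
      intros x t Ht; now apply density0_metric.
    + intros x t Ht; simpl.
      rewrite pdx_inv_sinu, density0_metric by assumption.
      unfold cosu; ring.
  - eapply local_law_conservation_law.
    + apply (local_law_density_ext _ _ _ _ L1).
      intros x t Ht; apply density1_metric.
    + intros x t Ht; now apply flux1_metric.
  - eapply (local_law_conserved (H2_density u) _ d2 0).
    + apply (local_law_density_ext _ _ _ _ L2).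
      intros x t Ht; now apply H2_density_metric.
    + intros x t Ht; apply continuity_2d_pt_section; now apply C2.
    + intros t Ht.
      destruct (sufficient_decay_far_field u t Hdecay Ht).
      split; now apply is_lim_total_flux2.
    + apply Hdecay.
  - eapply (local_law_conserved (H3_density u) _ d3 0).
    + apply (local_law_density_ext _ _ _ _ L3).
      intros x t Ht; now apply H3_density_metric.
    + intros x t Ht; apply continuity_2d_pt_section; now apply C3.
    + intros t Ht.
      destruct (sufficient_decay_far_field u t Hdecay Ht).
      split; now apply is_lim_total_flux3.
    + apply Hdecay.
Qed.
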